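(* Let $k$ be a real constant with $k\neq 0$. Then there is no 3-dimensional $\phi$-recurrent $N(k)$-contact metric manifold.
   Context: Manifolds are smooth and non-empty. A contact metric manifold is a $(2n+1)$-dimensional manifold $M$, $n\ge 1$, with a 1-form $\eta$ satisfying $\eta\wedge(d\eta)^n\neq 0$ everywhere, the characteristic vector field $\xi$ (determined by $\eta(\xi)=1$, $d\eta(\xi,\cdot)=0$), a Riemannian metric $g$ and a $(1,1)$-tensor field $\phi$ such that for all vector fields $X,Y$: $\eta(X)=g(X,\xi)$, $d\eta(X,Y)=g(X,\phi Y)$, $\phi^2X=-X+\eta(X)\xi$. Convention: $d\eta(X,Y)=\frac12\big(X\eta(Y)-Y\eta(X)-\eta([X,Y])\big)$. Let $\nabla$ be the Levi-Civita connection of $g$ and $R(X,Y)Z=\nabla_X\nabla_YZ-\nabla_Y\nabla_XZ-\nabla_{[X,Y]}Z$. The contact metric manifold is an $N(k)$-contact metric manifold, for a real constant $k$, if $R(X,Y)\xi=k[\eta(Y)X-\eta(X)Y]$ for all vector fields $X,Y$. It is $\phi$-recurrent if there exists a non-zero 1-form $A$ (i.e. not identically zero) such that $\phi^2((\nabla_WR)(X,Y)Z)=A(W)R(X,Y)Z$ for all vector fields $X,Y,Z,W$ (not necessarily orthogonal to $\xi$). *)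

(* Defs.v *)
From HB Require Import structures.
From mathcomp Require Import all_boot all_order all_algebra all_fingroup.
From mathcomp Require Import ring.
From mathcomp Require Import all_classical all_reals all_analysis.

Set Implicit Arguments.
Unset Strict Implicit.
Unset Printing Implicit Defensive.

Import Order.TTheory GRing.Theory Num.Theory.
Import numFieldNormedType.Exports.

Local Open Scope classical_set_scope.
Local Open Scope ring_scope.

(* Differential geometry is set up on the algebra of smooth functions of a
   manifold given by an atlas: vector fields are the derivations of that
   algebra, and tensor fields are the maps on vector fields that are linear
   over it in each argument. *)

Section Smoothness.
Variables (R : realType) (m : nat).
Implicit Types (U : set 'rV[R]_m) (f g : 'rV[R]_m -> R).

(* C^k on U by iterated partial derivatives; meaningful for U open, which is
   the only case in which it is used *)
Fixpoint Ck_on (k : nat) U f : Prop :=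
  (forall x, U x -> {for x, continuous f}) /\
  match k with
  | 0 => True
  | k'.+1 => forall i : 'I_m,
      (forall x, U x -> derivable f x (delta_mx 0 i)) /\
      Ck_on k' U ('D_(delta_mx 0 i) f)
  end.

Definition smooth_on U f : Prop := forall k, Ck_on k U f.

Lemma Ck_on_cont k U f : Ck_on k U f -> forall x, U x -> {for x, continuous f}.
Proof. by case: k => [|k] []. Qed.

Lemma Ck_on_pred k U f : Ck_on k.+1 U f -> Ck_on k U f.
Proof.
elim: k f => [|k IHk] f [cf df]; split=> // i.
by have [dfi Dfi] := df i; split=> //; apply: IHk.
Qed.

Lemma open_near_eq U f g x : open U -> (forall y, U y -> f y = g y) ->
  U x -> nbhs x (fun y => f y = g y).
Proof.
by move=> oU fg Ux; apply: (@filterS _ _ _ U) => //; exact: open_nbhs_nbhs.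
Qed.

Lemma continuous_on_ext U f g : open U -> (forall x, U x -> f x = g x) ->
  (forall x, U x -> {for x, continuous f}) ->
  forall x, U x -> {for x, continuous g}.
Proof.
move=> oU fg cf x Ux; rewrite /prop_for /continuous_at -(fg x Ux).
apply: cvg_trans (cf x Ux); apply: (@near_eq_cvg _ _ (nbhs x)).
exact: open_near_eq fg Ux.
Qed.

Lemma Ck_on_ext k U f g : open U -> (forall x, U x -> f x = g x) ->
  Ck_on k U f -> Ck_on k U g.
Proof.
move=> oU; elim: k f g => [|k IHk] f g fg [cf df].
  by split=> //; exact: continuous_on_ext cf.
have nfg x : U x -> nbhs x (fun y => f y = g y) by exact: open_near_eq.
split; first exact: continuous_on_ext cf.
move=> i; have [dfi Dfi] := df i; split.
  by move=> x Ux; apply: near_eq_derivable (dfi x Ux); exact: nfg.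
by apply: IHk Dfi => x Ux; apply: near_eq_derive; exact: nfg.
Qed.

Lemma Ck_on_cst k U (a : R) : open U -> Ck_on k U (cst a).
Proof.
move=> oU; have cc (a' : R) x : {for x, continuous (cst a' : 'rV[R]_m -> R)}.
  exact: cst_continuous.
elim: k a => [|k IHk] a; split; try by move=> *; exact: cc.
  by [].
move=> i; split; first by move=> x _; exact: derivable_cst.
by apply: Ck_on_ext (IHk 0) => // x _; rewrite derive_cst.
Qed.

Lemma Ck_onB k U f g : open U -> Ck_on k U f -> Ck_on k U g ->
  Ck_on k U (f - g).
Proof.
move=> oU; elim: k f g => [|k IHk] f g [cf df] [cg dg].
  by split=> // x Ux; apply: continuousB; [exact: cf | exact: cg].
split; first by move=> x Ux; apply: continuousB; [exact: cf | exact: cg].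
move=> i; have [dfi Dfi] := df i; have [dgi Dgi] := dg i; split.
  by move=> x Ux; apply: derivableB; [exact: dfi | exact: dgi].
apply: Ck_on_ext (IHk _ _ Dfi Dgi) => // x Ux.
by rewrite deriveB; [|exact: dfi|exact: dgi].
Qed.

Lemma Ck_onM k U f g : open U -> Ck_on k U f -> Ck_on k U g ->
  Ck_on k U (f * g).
Proof.
move=> oU; elim: k f g => [|k IHk] f g Cf Cg.
  split=> // x Ux; apply: continuousM; first exact: (Ck_on_cont Cf).
  exact: (Ck_on_cont Cg).
split.
  by move=> x Ux; apply: continuousM; [exact: (Ck_on_cont Cf)|exact: (Ck_on_cont Cg)].
move=> i; have [_ /(_ i) [dfi Dfi]] := Cf; have [_ /(_ i) [dgi Dgi]] := Cg.
split; first by move=> x Ux; apply: derivableM; [exact: dfi | exact: dgi].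
have C0 : Ck_on k U (cst 0 : 'rV[R]_m -> R) by exact: Ck_on_cst.
have CfD := IHk _ _ (Ck_on_pred Cf) Dgi.
have CgD := IHk _ _ (Ck_on_pred Cg) Dfi.
apply: Ck_on_ext (Ck_onB oU CfD (Ck_onB oU C0 CgD)) => // x Ux.
rewrite deriveM; [|exact: dfi|exact: dgi].
by rewrite -![RHS]/(f x * _ + g x * _) -![LHS]/(f x * _ - (0 - g x * _))
  sub0r opprK.
Qed.

End Smoothness.

Section Manifold.
Variables (R : realType).

(* a homeomorphism of the open set [chart_dom] onto the open set [chart_cod];
   both maps are total functions, with arbitrary values elsewhere *)
Record chart (T : topologicalType) (m : nat) := Chart {
  chart_dom : set T;
  chart_cod : set 'rV[R]_m;
  chart_map : T -> 'rV[R]_m;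
  chart_inv : 'rV[R]_m -> T;
  chart_dom_open : open chart_dom;
  chart_cod_open : open chart_cod;
  chart_map_cont : forall p, chart_dom p -> {for p, continuous chart_map};
  chart_inv_cont : forall x, chart_cod x -> {for x, continuous chart_inv};
  chart_mapP : forall p, chart_dom p -> chart_cod (chart_map p);
  chart_invP : forall x, chart_cod x -> chart_dom (chart_inv x);
  chart_mapK : forall p, chart_dom p -> chart_inv (chart_map p) = p;
  chart_invK : forall x, chart_cod x -> chart_map (chart_inv x) = x }.

Definition smooth_transition (T : topologicalType) (m : nat)
    (c c' : chart T m) : Prop :=
  forall j : 'I_m,
    smooth_on (chart_cod c `&` chart_inv c @^-1` chart_dom c')
              (fun x => chart_map c' (chart_inv c x) 0 j).

Record smooth_manifold (m : nat) := SmoothManifold {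
  carrier :> topologicalType;
  atlas : set (chart carrier m);
  manifold_nonempty : [set: carrier] !=set0;
  manifold_hausdorff : hausdorff_space carrier;
  manifold_second_countable : @second_countable carrier;
  atlas_cover : forall p : carrier, exists2 c, atlas c & chart_dom c p;
  atlas_compat : forall c c', atlas c -> atlas c' -> smooth_transition c c' }.

End Manifold.

Section SmoothFunctions.
Variables (R : realType) (m : nat) (M : smooth_manifold R m).

Definition smooth (f : M -> R) : Prop :=
  forall c, atlas c -> smooth_on (chart_cod c) (f \o chart_inv c).

Definition smoothb : {pred M -> R} := fun f => `[< smooth f >].

Lemma smooth_cst (a : R) : smooth (cst a).
Proof. by move=> c _ k; apply: Ck_on_cst; exact: chart_cod_open. Qed.

Lemma smoothB f g : smooth f -> smooth g -> smooth (f - g).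
Proof.
move=> sf sg c cA k; apply: Ck_onB; first exact: chart_cod_open.
- exact: sf.
- exact: sg.
Qed.

Lemma smoothM f g : smooth f -> smooth g -> smooth (f * g).
Proof.
move=> sf sg c cA k; apply: Ck_onM; first exact: chart_cod_open.
- exact: sf.
- exact: sg.
Qed.

Lemma smoothb_subring : subring_closed smoothb.
Proof.
split=> [|f g /asboolP sf /asboolP sg|f g /asboolP sf /asboolP sg].
- by apply/asboolP; exact: smooth_cst.
- by apply/asboolP; exact: smoothB.
- by apply/asboolP; exact: smoothM.
Qed.

HB.instance Definition _ :=
  GRing.isSubringClosed.Build (M -> R) smoothb smoothb_subring.

Record Cinfty := MkCinfty { Cinfty_val :> M -> R; _ : Cinfty_val \in smoothb }.

HB.instance Definition _ := [isSub of Cinfty for Cinfty_val].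
HB.instance Definition _ := [Choice of Cinfty by <:].
HB.instance Definition _ := 
  GRing.SubChoice_isSubComPzRing.Build (M -> R) smoothb Cinfty smoothb_subring.

Lemma Cinfty_oner_neq0 : 1 != 0 :> Cinfty.
Proof.
have [p _] := manifold_nonempty M; apply/eqP => /(congr1 (fun f : Cinfty => f p)).
exact/eqP/oner_neq0.
Qed.

HB.instance Definition _ :=
  GRing.PzSemiRing_isNonZero.Build Cinfty Cinfty_oner_neq0.

Lemma CinftyP (f g : Cinfty) : (forall p, f p = g p) -> f = g.
Proof. by move=> fg; apply/val_inj/funext. Qed.

Lemma smoothb_scale (a : R) (f : Cinfty) : cst a * (f : M -> R) \in smoothb.
Proof.
apply/asboolP/smoothM; first exact: smooth_cst.
by apply/asboolP; exact: (valP f).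
Qed.

Definition Cinfty_scale (a : R) (f : Cinfty) : Cinfty :=
  MkCinfty (smoothb_scale a f).

Lemma Cinfty_scalerA a b f :
  Cinfty_scale a (Cinfty_scale b f) = Cinfty_scale (a * b) f.
Proof. by apply: CinftyP => p; exact: mulrA. Qed.

Lemma Cinfty_scale1r : left_id 1 Cinfty_scale.
Proof. by move=> f; apply: CinftyP => p; exact: mul1r. Qed.

Lemma Cinfty_scalerDr : right_distributive Cinfty_scale +%R.
Proof. by move=> a f g; apply: CinftyP => p; exact: mulrDr. Qed.

Lemma Cinfty_scalerDl f : {morph Cinfty_scale^~ f : a b / a + b}.
Proof. by move=> a b; apply: CinftyP => p; exact: mulrDl. Qed.

HB.instance Definition _ := GRing.Zmodule_isLmodule.Build R Cinfty
  Cinfty_scalerA Cinfty_scale1r Cinfty_scalerDr Cinfty_scalerDl.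

Lemma Cinfty_scalerAl (a : R) (f g : Cinfty) : a *: (f * g) = (a *: f) * g.
Proof. by apply: CinftyP => p; exact: mulrA. Qed.

HB.instance Definition _ :=
  GRing.Lmodule_isLalgebra.Build R Cinfty Cinfty_scalerAl.
HB.instance Definition _ := GRing.Lalgebra_isComAlgebra.Build R Cinfty.

End SmoothFunctions.

Section VectorFields.
Variables (R : realType) (m : nat) (M : smooth_manifold R m).
Local Notation C := (Cinfty M).

(* R-linearity and the Leibniz rule; the codomain is [C^o] so that derivations
   inherit the pointwise C-module structure (h X) f = h (X f) *)
Definition derivation (X : C -> C^o) : Prop :=
  (forall (a : R) (f g : C), X (a *: f + g) = (a *: (X f : C) + X g : C)) /\
  (forall f g : C, X (f * g) = (X f : C) * g + f * (X g : C)).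

Definition derivationb : {pred C -> C^o} := fun X => `[< derivation X >].

Lemma derivationb_submod : submod_closed derivationb.
Proof.
split.
  apply/asboolP; split=> [a f g|f g].
    by rewrite -[LHS]/(0 : C) -[RHS]/(a *: (0 : C) + 0 : C) scaler0 addr0.
  by rewrite -[LHS]/(0 : C) -[RHS]/((0 : C) * g + f * (0 : C) : C)
    mul0r mulr0 addr0.
move=> h X Y /asboolP[XL XM] /asboolP[YL YM]; apply/asboolP.
have E f : (h *: X + Y) f = (h * (X f : C) + (Y f : C) : C) by [].
split=> [a f g|f g]; rewrite !E.
  rewrite XL YL mulrDr scalerDr scalerAr -!addrA; congr (_ + _).
  by rewrite addrCA.
rewrite XM YM !mulrDr !mulrDl !mulrA [h * f]mulrC -!addrA; congr (_ + _).
by rewrite addrCA.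
Qed.

HB.instance Definition _ :=
  GRing.isSubmodClosed.Build C (C -> C^o) derivationb derivationb_submod.

Record vfield := MkVfield {
  vfield_val :> C -> C^o;
  _ : vfield_val \in derivationb }.

HB.instance Definition _ := [isSub for vfield_val].
HB.instance Definition _ := [Choice of vfield by <:].
HB.instance Definition _ := [SubChoice_isSubLmodule of vfield by <:].

Lemma vfield_derivation (X : vfield) : derivation X.
Proof. by apply/asboolP; exact: (valP X). Qed.

Definition bracket_fun (X Y : vfield) : C -> C^o :=
  fun f => (X (Y f) - Y (X f) : C).

Lemma bracket_derivation X Y : bracket_fun X Y \in derivationb.
Proof.
have [XL XM] := vfield_derivation X; have [YL YM] := vfield_derivation Y.
have XD f g : X (f + g) = (X f + X g : C).
  by rewrite -[f in LHS]scale1r XL scale1r.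
have YD f g : Y (f + g) = (Y f + Y g : C).
  by rewrite -[f in LHS]scale1r YL scale1r.
apply/asboolP; split=> [a f g|f g]; rewrite /bracket_fun.
  rewrite [Y (a *: f + g)]YL [X (a *: f + g)]XL XL YL scalerBr opprD.
  by rewrite addrACA.
rewrite [Y (f * g)]YM [X (f * g)]XM XD YD !XM !YM mulrBl mulrBr.
ring.
Qed.

Definition bracket (X Y : vfield) : vfield := MkVfield (bracket_derivation X Y).

(* the value of X at p as a tangent vector, i.e. as a derivation at p *)
Definition vfield_at (X : vfield) (p : M) : C -> R := fun f => (X f : C) p.

End VectorFields.

Section TensorFields.
Variables (R : realType) (m : nat) (M : smooth_manifold R m).
Local Notation C := (Cinfty M).
Local Notation V := (vfield M).

Definition one_form := {scalar V}.

Definition ext_deriv (eta : one_form) (X Y : V) : C :=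
  2^-1 *: ((X (eta Y) : C) - (Y (eta X) : C) - eta (bracket X Y)).

Definition cochain (k : nat) := ('I_k -> V) -> C.

Definition cochain1 (eta : one_form) : cochain 1 := fun X => eta (X ord0).

Definition cochain2 (omega : V -> V -> C) : cochain 2 :=
  fun X => omega (X ord0) (X ord_max).

(* normalized as Alt (a (x) b), the convention that goes with the
   factor 1/2 in [ext_deriv] *)
Definition wedge (k l : nat) (a : cochain k) (b : cochain l) :
    cochain (k + l) :=
  fun X => ((k + l)`!%:R : R)^-1 *: \sum_(s : 'S_(k + l))
    (-1) ^+ s * (a (fun i => X (s (lshift l i))) *
                 b (fun j => X (s (rshift k j)))).

Fixpoint wedge_pow (omega : cochain 2) (n : nat) : cochain (n * 2) :=
  match n with
  | 0 => fun=> 1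
  | n'.+1 => wedge omega (@wedge_pow omega n')
  end.

(* every tangent vector at p is the value at p of a vector field *)
Definition nonzero_at (k : nat) (omega : cochain k) (p : M) : Prop :=
  exists X : 'I_k -> V, omega X p != 0.

Record riemannian_metric := RiemannianMetric {
  metric :> V -> V -> C;
  metric_sym : forall X Y, metric X Y = metric Y X;
  metric_linear : forall (f : C) (X Y Z : V),
    metric (f *: X + Y) Z = f * metric X Z + metric Y Z;
  metric_pos : forall (X : V) (p : M),
    vfield_at X p <> (fun=> 0) -> 0 < metric X X p }.

Record affine_connection := AffineConnection {
  covd :> V -> V -> V;
  covd_linearl : forall (f : C) (W W' X : V),
    covd (f *: W + W') X = f *: covd W X + covd W' X;
  covd_addr : forall W X Y : V, covd W (X + Y) = covd W X + covd W Y;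
  covd_leibniz : forall (f : C) (W X : V),
    covd W (f *: X) = (W f : C) *: X + f *: covd W X }.

Definition torsion_free (D : affine_connection) : Prop :=
  forall X Y : V, D X Y - D Y X = bracket X Y.

Definition metric_compatible (g : riemannian_metric) (D : affine_connection) :
    Prop :=
  forall X Y Z : V, (X (g Y Z) : C) = g (D X Y) Z + g Y (D X Z).

Definition levi_civita (g : riemannian_metric) (D : affine_connection) : Prop :=
  torsion_free D /\ metric_compatible g D.

Definition curvature (D : affine_connection) (X Y Z : V) : V :=
  D X (D Y Z) - D Y (D X Z) - D (bracket X Y) Z.

(* (nabla_W R)(X, Y) Z *)
Definition covd_curvature (D : affine_connection) (W X Y Z : V) : V :=
  D W (curvature D X Y Z) - curvature D (D W X) Y Z
  - curvature D X (D W Y) Z - curvature D X Y (D W Z).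

End TensorFields.

Section ContactMetric.
Variables (R : realType).

Record contact_metric (n : nat) (M : smooth_manifold R (n * 2).+1) :=
  ContactMetric {
  cm_eta : one_form M;
  cm_xi : vfield M;
  cm_g : riemannian_metric M;
  cm_phi : {linear vfield M -> vfield M};
  cm_n_gt0 : (0 < n)%N;
  cm_contact : forall p : M,
    nonzero_at
      (wedge (cochain1 cm_eta) (@wedge_pow _ _ M (cochain2 (ext_deriv cm_eta)) n)) p;
  cm_eta_xi : cm_eta cm_xi = 1;
  cm_deta_xi : forall X, ext_deriv cm_eta cm_xi X = 0;
  cm_eta_g : forall X, cm_eta X = cm_g X cm_xi;
  cm_deta_g : forall X Y, ext_deriv cm_eta X Y = cm_g X (cm_phi Y);
  cm_phi2 : forall X, cm_phi (cm_phi X) = - X + cm_eta X *: cm_xi }.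

Variables (n : nat) (M : smooth_manifold R (n * 2).+1) (S : contact_metric M).

Definition N_contact (D : affine_connection M) (k : R) : Prop :=
  forall X Y : vfield M,
    curvature D X Y (cm_xi S) =
    (k *: cm_eta S Y) *: X - (k *: cm_eta S X) *: Y.

Definition phi_recurrent (D : affine_connection M) : Prop :=
  exists A : one_form M,
    (exists W : vfield M, A W != 0) /\
    forall X Y Z W : vfield M,
      cm_phi S (cm_phi S (covd_curvature D W X Y Z)) =
      A W *: curvature D X Y Z.

End ContactMetric.

(* Main.v *)
Require Import Defs.
From mathcomp Require Import all_boot all_order all_algebra.
From mathcomp Require Import ring.
From mathcomp Require Import all_classical all_reals all_analysis.
Import GRing.Theory Num.Theory.
Local Open Scope ring_scope.

(** Since [eta \o phi^2 = 0], applying [eta] to the recurrence identity kills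
    its left-hand side, so [A(W) g(R(X,Y)Z, xi) = 0]. As [R(X,Y)] is skew for
    [g], the N(k) condition turns this, for [Y = xi] and [k != 0], into
    [A(W) (g(X,Z) - eta(X) eta(Z)) = 0]. For [Z = phi V] this reads
    [A(W) d eta(X,V) = 0], hence [A(W) (eta /\ d eta) = 0]; the contact form
    vanishes nowhere, so [A = 0]. *)

Section Curvature.
Context {R : realType} {m : nat} {M : smooth_manifold R m}.
Implicit Types (X Y Z W : vfield M) (g : riemannian_metric M)
  (D : affine_connection M).

Lemma vfieldD X (f h : Cinfty M) : X (f + h) = (X f + X h : Cinfty M).
Proof.
have [XL _] := vfield_derivation X.
by rewrite -[f in LHS]scale1r XL scale1r.
Qed.

Lemma metricBl g X Y Z : g (X - Y) Z = g X Z - g Y Z.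
Proof. by rewrite addrC -scaleN1r metric_linear mulN1r addrC. Qed.

Lemma metricZl g (f : Cinfty M) X Y : g (f *: X) Y = f * g X Y.
Proof.
have g0 : g 0 Y = 0 by rewrite -(subrr X) metricBl subrr.
by rewrite -[f *: X]addr0 metric_linear g0 addr0.
Qed.

(** The bracket acts on the function [g Z W] as the commutator of [X] and [Y]. After expansion by
    metric compatibility, mixed terms such as g(D_X Z, D_Y W) cancel. *)
Lemma curvature_skew g D X Y Z W : metric_compatible g D ->
  g (curvature D X Y Z) W = - g (curvature D X Y W) Z.
Proof.
move=> gD; rewrite /curvature !metricBl.
have : bracket X Y (g Z W) =
    (X (Y (g Z W)) : Cinfty M) - (Y (X (g Z W)) : Cinfty M) :> Cinfty M by [].
rewrite !gD !vfieldD !gD !(Defs.metric_sym g Z) => E.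
rewrite -[g (D (bracket X Y) Z) W](addrK (g (D (bracket X Y) W) Z)) E.
ring.
Qed.

End Curvature.

Section Wedge.
Context {R : realType} {m : nat} {M : smooth_manifold R m}.
Variables (k l : nat) (a : cochain M k) (b : cochain M l) (f : Cinfty M).

(** Smooth functions have zero divisors, so vanishing is carried through the wedge as a product with
    [f]; every term of the alternating sum contains a value of [a]. *)
Lemma mul_wedge_eq0l : (forall X, f * a X = 0) ->
  forall X, f * wedge a b X = 0.
Proof.
move=> fa X; rewrite /wedge -scalerAr mulr_sumr big1 ?scaler0 // => s _.
by rewrite mulrCA [f * _]mulrA fa mul0r mulr0.
Qed.

Lemma mul_wedge_eq0r : (forall X, f * b X = 0) ->
  forall X, f * wedge a b X = 0.
Proof.
move=> fb X; rewrite /wedge -scalerAr mulr_sumr big1 ?scaler0 // => s _.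
by rewrite mulrCA [f * _]mulrCA fb !mulr0.
Qed.

End Wedge.

Section Contact.
Context {R : realType} {n : nat} {M : smooth_manifold R (n * 2).+1}.
Variable S : contact_metric M.
Implicit Types X Y Z W : vfield M.

Lemma cm_eta_phi X : cm_eta S (cm_phi S X) = 0.
Proof. by rewrite cm_eta_g Defs.metric_sym -cm_deta_g cm_deta_xi. Qed.

Lemma phi_recurrent_eta_curvature D (A : one_form M) :
    (forall X Y Z W, cm_phi S (cm_phi S (covd_curvature D W X Y Z)) =
                     A W *: curvature D X Y Z) ->
  forall X Y Z W, A W * cm_eta S (curvature D X Y Z) = 0.
Proof.
by move=> recA X Y Z W; rewrite -[LHS]linearZ -recA cm_eta_phi.
Qed.

End Contact.

Theorem corollary3p6 (R : realType) (k : R) (hk : k != 0) :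
  ~ exists (M : smooth_manifold R 3) (S : contact_metric (n := 1) M)
           (nabla : affine_connection M),
      [/\ levi_civita (cm_g S) nabla,
          N_contact S nabla k
        & phi_recurrent S nabla].
Proof.
move=> [M [S [D [[_ gD] nD [A [[W AW] recA]]]]]].
have Adeta X V : A W * ext_deriv (cm_eta S) X V = 0.
  (* Skewness and N(k) give eta(R(X,xi) phi V) = -k (d eta(X,V) - eta(X) eta(phi V)), where eta(phi
     V) = 0. *)
  have := phi_recurrent_eta_curvature _ _ _ recA X (cm_xi S) (cm_phi S V) W.
  rewrite cm_eta_g (curvature_skew _ _ _ _ _ _ gD) nD metricBl !metricZl.
  rewrite -[cm_g S (cm_xi S) _]Defs.metric_sym -cm_eta_g cm_eta_phi mulr0 subr0.
  rewrite cm_eta_xi -cm_deta_g mulrN => /eqP.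
  rewrite oppr_eq0 -!scalerAl mul1r -scalerAr => /eqP E.
  by rewrite -[LHS]scale1r -(mulVf hk) -scalerA E scaler0.
move/eqP: AW; apply; apply: CinftyP => p.
have [X] := cm_contact S p; set w := wedge _ _ => wp.
have : A W * w X = 0.
  (* For n = 1 the form unfolds to eta /\ (d eta /\ 1), so d eta is the left factor of the right
     factor. *)
  by apply: mul_wedge_eq0r => Y; apply: mul_wedge_eq0l => Z; exact: Adeta.
move/(congr1 (fun f : Cinfty M => f p)) => /eqP.
(* At [p] the values lie in the field [R], so [w X p != 0] forces [A W p = 0]. *)
rewrite -[X in X == _]/(A W p * w X p) mulf_eq0 (negPf wp) orbF => /eqP.
exact.
Qed.
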